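(* Let $\{H_1,H_2,\dots,H_m,E_1,\dots,E_n\}$ be a collection of $m\ge 2$ hyperbolic transformations $H_i$ and $n\ge 0$ elliptic transformations $E_i$ in $\mathrm{PGL}_2(\mathbb{C})$, each without repeated eigenvalues and where $H_1$ and $H_2$ do not share the same pair of eigendirections. Denote the eigendirections of $H_i$ by $h_i^-,h_i^+$ and those of $E_i$ by $e_i^-,e_i^+$ (points of $\mathbb{C}P^1=\hat{\mathbb{C}}$). Then the collection is simultaneously conjugate into $\mathrm{PGL}_2(\mathbb{R})$ if and only if all of the following hold: (a) $[h_1^-,h_2^-,h_1^+,h_2^+]\in\hat{\mathbb{R}}$; for each $H_i$ with $i>2$, (b) $[h_1^-,h_i^-,h_1^+,h_2^-]\in\hat{\mathbb{R}}$ and (c) $[h_1^-,h_i^+,h_1^+,h_2^-]\in\hat{\mathbb{R}}$; and for each $E_i$, (d) $[h_1^-,e_i^-,h_1^+,h_2^-]=\overline{[h_1^-,e_i^+,h_1^+,h_2^-]}$.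
   Context: $\hat{\mathbb{C}}=\mathbb{C}\cup\{\infty\}$ and $\hat{\mathbb{R}}=\mathbb{R}\cup\{\infty\}$. The cross ratio of a quadruple of points of $\hat{\mathbb{C}}$ is $$[A,B,C,D]=\frac{(A-D)(C-B)}{(A-B)(C-D)},$$ i.e. the image of $B$ under the Möbius transformation with $A\mapsto\infty$, $C\mapsto 0$, $D\mapsto 1$. $\mathrm{PGL}_2(\mathbb{R})$ is regarded as the image of $\mathrm{GL}_2(\mathbb{R})$ in $\mathrm{PGL}_2(\mathbb{C})$. A collection $\{M_j\}\subset \mathrm{PGL}_2(\mathbb{C})$ is simultaneously conjugate into $\mathrm{PGL}_2(\mathbb{R})$ if there is a single $\Gamma\in \mathrm{PGL}_2(\mathbb{C})$ with $\Gamma^{-1}M_j\Gamma\in \mathrm{PGL}_2(\mathbb{R})$ for all $j$. An element of $\mathrm{PGL}_2(\mathbb{C})$ is hyperbolic if the two eigenvalues of a representative lie on a common real line through $0$ in $\mathbb{C}$, and elliptic if they are swapped by reflection about some real line through $0$ in $\mathbb{C}$.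
   Formalization: Adds that no H_i is also elliptic and no E_i also hyperbolic (this excludes involutions, for which ''only if'' fails), and that h_2^- is not an eigendirection of H_1 (a choice of labels; otherwise (b)-(d) can be vacuous and ''if'' fails). *)

(* Defs.v *)
From HB Require Import structures.
From mathcomp Require Import all_boot all_order all_algebra.
From mathcomp Require Import complex.
From mathcomp Require Import all_classical reals.

Set Implicit Arguments.
Unset Strict Implicit.
Unset Printing Implicit Defensive.

Import GRing.Theory.

Local Open Scope quotient_scope.
Local Open Scope complex_scope.
Local Open Scope ring_scope.

Section PGL2.
Variable F : fieldType.

Record GL2 := MkGL2 { GL2_mx :> 'M[F]_2; _ : GL2_mx \in unitmx }.
HB.instance Definition _ := [isSub for GL2_mx].
HB.instance Definition _ := [Choice of GL2 by <:].
Implicit Types A B : GL2.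

Lemma GL2_mul_subproof A B : val A *m val B \in unitmx.
Proof. by rewrite unitmx_mul (valP A) (valP B). Qed.

Lemma GL2_inv_subproof A : invmx (val A) \in unitmx.
Proof. by rewrite unitmx_inv (valP A). Qed.

Definition GL2_one : GL2 := MkGL2 (unitmx1 F 2).
Definition GL2_mul A B : GL2 := MkGL2 (GL2_mul_subproof A B).
Definition GL2_inv A : GL2 := MkGL2 (GL2_inv_subproof A).

Fact GL2_mulA : associative GL2_mul.
Proof. by move=> A B C; apply: val_inj; rewrite /= mulmxA. Qed.
Fact GL2_mul1 : left_id GL2_one GL2_mul.
Proof. by move=> A; apply: val_inj; rewrite /= mul1mx. Qed.
Fact GL2_mulr1 : right_id GL2_one GL2_mul.
Proof. by move=> A; apply: val_inj; rewrite /= mulmx1. Qed.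
Fact GL2_mulV : left_inverse GL2_one GL2_inv GL2_mul.
Proof. by move=> A; apply: val_inj; rewrite /= mulVmx // (valP A). Qed.
Fact GL2_mulrV : right_inverse GL2_one GL2_inv GL2_mul.
Proof. by move=> A; apply: val_inj; rewrite /= mulmxV // (valP A). Qed.

HB.instance Definition _ := isGroup.Build GL2
  GL2_mulA GL2_mul1 GL2_mulr1 GL2_mulV GL2_mulrV.

Definition proportional : rel GL2 :=
  fun A B => `[< exists c : F, val A = c *: val B >].

Lemma GL2_neq0 A : val A != 0.
Proof.
apply/eqP=> A0; have := valP A.
by rewrite A0 unitmxE det0 unitr0.
Qed.

Lemma proportionalP A B :
  reflect (exists2 c : F, c != 0 & val A = c *: val B) (proportional A B).
Proof.
apply: (iffP (asboolP _)) => [[c AB]|[c _ AB]]; last by exists c.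
exists c => //; apply/eqP => c0.
by have := GL2_neq0 A; rewrite AB c0 scale0r eqxx.
Qed.

Fact proportional_refl : reflexive proportional.
Proof. by move=> A; apply/asboolP; exists 1; rewrite scale1r. Qed.

Fact proportional_sym : symmetric proportional.
Proof.
suff H A B : proportional A B -> proportional B A.
  by move=> A B; apply/idP/idP; apply: H.
case/proportionalP=> c c0 AB; apply/asboolP; exists c^-1.
by rewrite AB scalerA mulVf // scale1r.
Qed.

Fact proportional_trans : transitive proportional.
Proof.
move=> B A C /asboolP[c AB] /asboolP[d BC]; apply/asboolP; exists (c * d).
by rewrite AB BC scalerA.
Qed.

Canonical proportional_equiv := EquivRel proportional
  proportional_refl proportional_sym proportional_trans.

Definition PGL2 := {eq_quot proportional}.
HB.instance Definition _ : EqQuotient GL2 proportional PGL2 :=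
  EqQuotient.on PGL2.
HB.instance Definition _ := Choice.on PGL2.

Definition PGL2_mul (x y : PGL2) : PGL2 := \pi_PGL2 (repr x * repr y)%g.
Definition PGL2_inv (x : PGL2) : PGL2 := \pi_PGL2 (repr x)^-1%g.
Definition PGL2_one : PGL2 := \pi_PGL2 1%g.

Lemma PGL2_piP A B :
  reflect (exists2 c : F, c != 0 & val A = c *: val B)
          (\pi_PGL2 A == \pi_PGL2 B).
Proof. by rewrite eqmodE; apply: proportionalP. Qed.

Lemma PGL2_piM A B :
  PGL2_mul (\pi_PGL2 A) (\pi_PGL2 B) = \pi_PGL2 (A * B)%g.
Proof.
apply/eqP/PGL2_piP.
have /eqP/PGL2_piP[c c0 Ec] : \pi_PGL2 (repr (\pi_PGL2 A)) = \pi_PGL2 A.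
  by rewrite reprK.
have /eqP/PGL2_piP[d d0 Ed] : \pi_PGL2 (repr (\pi_PGL2 B)) = \pi_PGL2 B.
  by rewrite reprK.
exists (c * d); first by rewrite mulf_neq0.
by rewrite /= Ec Ed -scalemxAl -scalemxAr scalerA.
Qed.

Lemma PGL2_piV A : PGL2_inv (\pi_PGL2 A) = \pi_PGL2 A^-1%g.
Proof.
apply/eqP/PGL2_piP.
have /eqP/PGL2_piP[c c0 Ec] : \pi_PGL2 (repr (\pi_PGL2 A)) = \pi_PGL2 A.
  by rewrite reprK.
exists c^-1; first by rewrite invr_eq0.
by rewrite /= Ec invmxZ // unitmxZ ?unitfE // (valP A).
Qed.

Fact PGL2_mulA : associative PGL2_mul.
Proof.
elim/quotW=> A; elim/quotW=> B; elim/quotW=> C.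
by rewrite (PGL2_piM B C) (PGL2_piM A B) (PGL2_piM A) (PGL2_piM _ C) mulgA.
Qed.
Fact PGL2_mul1 : left_id PGL2_one PGL2_mul.
Proof. by elim/quotW=> A; rewrite /PGL2_one PGL2_piM mul1g. Qed.
Fact PGL2_mulr1 : right_id PGL2_one PGL2_mul.
Proof. by elim/quotW=> A; rewrite /PGL2_one PGL2_piM mulg1. Qed.
Fact PGL2_mulV : left_inverse PGL2_one PGL2_inv PGL2_mul.
Proof. by elim/quotW=> A; rewrite /PGL2_one PGL2_piV PGL2_piM mulVg. Qed.
Fact PGL2_mulrV : right_inverse PGL2_one PGL2_inv PGL2_mul.
Proof. by elim/quotW=> A; rewrite /PGL2_one PGL2_piV PGL2_piM mulgV. Qed.

HB.instance Definition _ := isGroup.Build PGL2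
  PGL2_mulA PGL2_mul1 PGL2_mulr1 PGL2_mulV PGL2_mulrV.

End PGL2.

Section Complex.
Variable R : realType.
Local Notation C := R[i].

Lemma GL2_complex_subproof (A : GL2 R) :
  map_mx (real_complex R) (val A) \in unitmx.
Proof. by rewrite map_unitmx (valP A). Qed.

Definition GL2_complex (A : GL2 R) : GL2 C := MkGL2 (GL2_complex_subproof A).

Definition PGL2_real : set (PGL2 C) :=
  [set \pi_(PGL2 C) (GL2_complex A) | A in [set: GL2 R]]%classic.

Definition simultaneously_conjugate_into_PGL2_real (S : set (PGL2 C)) : Prop :=
  exists G : PGL2 C, forall M, S M -> PGL2_real (G^-1 * M * G)%g.

(* [None] is the point at infinity. *)
Definition Chat := option C.

Definition Rhat : set Chat :=
  [set z | z = None \/ exists x : R, z = Some x%:C]%classic.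

Definition conj_hat (z : Chat) : Chat := omap (@conjc R) z.

(* Identification of [Chat] with the projective line: z is sent to [z : 1] and
   infinity to [1 : 0]. *)
Definition hom_coord (z : Chat) : 'cV[C]_2 :=
  \col_(i < 2) match z with
               | Some w => if i == 0 then w else 1
               | None => if i == 0 then 1 else 0
               end.

Definition bracket (P Q : Chat) : C :=
  hom_coord P 0 0 * hom_coord Q 1 0 - hom_coord P 1 0 * hom_coord Q 0 0.

(* (A - D)(C - B) / ((A - B)(C - D)), homogenised so as to make sense for
   points at infinity and for coinciding points.  The quotient is of the form
   0/0 only when three of the four points coincide; the value is then
   [None] by convention. *)
Definition cross_ratio (A B C D : Chat) : Chat :=
  let num := bracket A D * bracket C B in
  let den := bracket A B * bracket C D in
  if den == 0 then None else Some (num / den).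

Lemma bracketE P Q :
  bracket P Q = match P, Q with
                | Some p, Some q => p - q
                | Some _, None => -1
                | None, Some _ => 1
                | None, None => 0
                end.
Proof.
rewrite /bracket !mxE /=; case: P => [p|]; case: Q => [q|];
by rewrite ?mul1r ?mulr1 ?mulr0 ?mul0r ?subr0 ?sub0r ?subrr.
Qed.

Lemma cross_ratio_finite (a b c d : C) : a != b -> c != d ->
  cross_ratio (Some a) (Some b) (Some c) (Some d) =
  Some ((a - d) * (c - b) / ((a - b) * (c - d))).
Proof.
move=> ab cd; rewrite /cross_ratio !bracketE.
by rewrite mulf_eq0 !subr_eq0 (negPf ab) (negPf cd).
Qed.

Lemma bracket_eq0 P Q : (bracket P Q == 0) = (P == Q).
Proof.
rewrite bracketE; case: P => [p|]; case: Q => [q|]; rewrite ?eqxx //.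
- by rewrite subr_eq0; apply/eqP/eqP => [->|[->]].
- by rewrite oppr_eq0 oner_eq0.
- by rewrite oner_eq0.
Qed.

Lemma bracketC P Q : bracket P Q = - bracket Q P.
Proof.
by rewrite !bracketE; case: P => [p|]; case: Q => [q|];
  rewrite ?opprB ?opprK ?oppr0.
Qed.

Lemma cross_ratio_infty A C D : cross_ratio A A C D = None.
Proof.
by rewrite /cross_ratio (eqP (_ : bracket A A == 0)) ?bracket_eq0 // mul0r eqxx.
Qed.

Lemma cross_ratio0 A C D : A != C -> C != D -> cross_ratio A C C D = Some 0.
Proof.
move=> nAC nCD; rewrite /cross_ratio mulf_eq0 !bracket_eq0 (negPf nAC) (negPf nCD) /=.
by rewrite (eqP (_ : bracket C C == 0)) ?bracket_eq0 // mulr0 mul0r.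
Qed.

Lemma cross_ratio1 A C D : A != D -> C != D -> cross_ratio A D C D = Some 1.
Proof.
move=> AD CD; rewrite /cross_ratio mulf_eq0 !bracket_eq0 (negPf AD) (negPf CD) /=.
by rewrite divff // mulf_eq0 !bracket_eq0 (negPf AD) (negPf CD).
Qed.

(* [l1] and [l2] are the two eigenvalues, with multiplicity, of some
   representative of [M]; they are defined up to a common nonzero factor. *)
Definition eigenvalue_pair (M : PGL2 C) (l1 l2 : C) : Prop :=
  exists2 A : GL2 C, \pi_(PGL2 C) A = M &
    char_poly (val A) = ('X - l1%:P) * ('X - l2%:P).

Definition distinct_eigenvalues (M : PGL2 C) : Prop :=
  exists l1 l2 : C, eigenvalue_pair M l1 l2 /\ l1 != l2.

Definition real_line (u : C) : set C := [set z | exists t : R, z = t%:C * u]%classic.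

(* Reflection about [real_line u], for [u] nonzero. *)
Definition reflection (u z : C) : C := u / conjc u * conjc z.

Definition hyperbolic (M : PGL2 C) : Prop :=
  exists l1 l2 : C, eigenvalue_pair M l1 l2 /\
    exists2 u : C, u != 0 & real_line u l1 /\ real_line u l2.

(* With distinct eigenvalues, [hyperbolic] and [elliptic] hold together exactly
   when the eigenvalues are opposite, i.e. for involutions. *)
Definition elliptic (M : PGL2 C) : Prop :=
  exists l1 l2 : C, eigenvalue_pair M l1 l2 /\
    exists2 u : C, u != 0 & reflection u l1 = l2 /\ reflection u l2 = l1.

(* Matrices act on column vectors, so that a class acts on [Chat] by
   z |-> (a z + b) / (c z + d). *)
Definition eigendirections (M : PGL2 C) : set Chat :=
  [set z | exists2 A : GL2 C, \pi_(PGL2 C) A = M &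
     exists l : C, val A *m hom_coord z = l *: hom_coord z]%classic.

End Complex.

(* Main.v *)
(** Conjugating by [G] moves eigendirections by the Moebius action of [G^-1].
    A real matrix with distinct eigenvalues has either real eigenvalues and real
    eigendirections, or conjugate eigenvalues and conjugate eigendirections;
    conversely such eigendata force the matrix to equal its conjugate, since both
    agree on a basis.  Hence [G] conjugates the collection into PGL_2(R) iff
    [G^-1] sends hyperbolic eigendirections to real points and the two
    eigendirections of each elliptic element to conjugate points.  Cross ratios
    being Moebius invariant and compatible with conjugation, such a [G] forces
    (a)-(d).  For the converse, take for [G^-1] the map sending h_1^-, h_1^+, h_2^-
    to infinity, 0, 1, which is z |-> [h_1^-, z, h_1^+, h_2^-]. *)

Require Import Defs.
From mathcomp Require Import all_boot all_order all_algebra.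
From mathcomp Require Import complex ring.
From mathcomp Require Import all_classical reals.

Set Implicit Arguments.
Unset Strict Implicit.
Unset Printing Implicit Defensive.

Import GRing.Theory Num.Theory.

Local Open Scope complex_scope.
Local Open Scope classical_set_scope.
Local Open Scope ring_scope.

(** * Linear algebra of two-by-two matrices *)

Lemma mulmx2E (F : pzSemiRingType) (m n : nat) (A : 'M[F]_(m, 2)) (B : 'M_(2, n))
    i j :
  (A *m B) i j = A i 0 * B 0 j + A i 1 * B 1 j.
Proof. by rewrite mxE big_ord_recl big_ord1; congr (_ + A i _ * B _ j); apply: val_inj. Qed.

Lemma det2E (F : comPzRingType) (A : 'M[F]_2) :
  \det A = A 0 0 * A 1 1 - A 0 1 * A 1 0.
Proof.
rewrite (expand_det_row _ 0) big_ord_recl big_ord1 /cofactor !det_mx11 !mxE /=.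
rewrite expr0 mul1r expr1 mulN1r mulrN.
by congr (A _ _ * A _ _ - A _ _ * A _ _); apply: val_inj.
Qed.

Lemma ord2P (P : 'I_2 -> Prop) : P 0 -> P 1 -> forall i, P i.
Proof.
move=> P0 P1 i; case: (unliftP 0 i) => [j ->|-> //].
by rewrite (_ : lift 0 j = 1) //; apply: val_inj; rewrite ord1.
Qed.

Lemma colvec2P (F : Type) (u v : 'cV[F]_2) :
  u 0 0 = v 0 0 -> u 1 0 = v 1 0 -> u = v.
Proof. by move=> u0 u1; apply/matrixP=> i j; rewrite ord1; elim/ord2P: i. Qed.

(** Determinant of the matrix with columns [u] and [v]; on homogeneous coordinates it is
    [bracket]. *)
Definition wedge (F : pzRingType) (u v : 'cV[F]_2) : F :=
  u 0 0 * v 1 0 - u 1 0 * v 0 0.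

Lemma wedge_mulmx (F : comPzRingType) (A : 'M[F]_2) (u v : 'cV_2) :
  wedge (A *m u) (A *m v) = \det A * wedge u v.
Proof. by rewrite /wedge !mulmx2E det2E; ring. Qed.

Lemma wedgeZ (F : comPzRingType) (a b : F) (u v : 'cV_2) :
  wedge (a *: u) (b *: v) = a * b * wedge u v.
Proof. by rewrite /wedge !mxE; ring. Qed.

(** Cramer's rule, row by row: eliminating one of the two entries isolates the other, multiplied by
    [wedge u v]. *)
Lemma mulmx_wedge_inj (F : fieldType) (m : nat) (A B : 'M[F]_(m, 2)) (u v : 'cV_2) :
  wedge u v != 0 -> A *m u = B *m u -> A *m v = B *m v -> A = B.
Proof.
move=> uv0 Au Av; apply/matrixP => i j.
have Eu : A i 0 * u 0 0 + A i 1 * u 1 0 = B i 0 * u 0 0 + B i 1 * u 1 0.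
  by rewrite -!mulmx2E Au.
have Ev : A i 0 * v 0 0 + A i 1 * v 1 0 = B i 0 * v 0 0 + B i 1 * v 1 0.
  by rewrite -!mulmx2E Av.
apply: (mulIf uv0); rewrite /wedge.
by elim/ord2P: j; [have : (A i 0 * u 0 0 + A i 1 * u 1 0) * v 1 0 -
     (A i 0 * v 0 0 + A i 1 * v 1 0) * u 1 0 =
     (B i 0 * u 0 0 + B i 1 * u 1 0) * v 1 0 -
     (B i 0 * v 0 0 + B i 1 * v 1 0) * u 1 0 by rewrite Eu Ev
  | have : (A i 0 * v 0 0 + A i 1 * v 1 0) * u 0 0 -
     (A i 0 * u 0 0 + A i 1 * u 1 0) * v 0 0 =
     (B i 0 * v 0 0 + B i 1 * v 1 0) * u 0 0 -
     (B i 0 * u 0 0 + B i 1 * u 1 0) * v 0 0 by rewrite Eu Ev];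
  move=> Euv; apply: etrans (etrans Euv _); ring.
Qed.

Lemma char_poly_trmx (F : comNzRingType) (n : nat) (A : 'M[F]_n) :
  char_poly A^T = char_poly A.
Proof.
rewrite /char_poly -[in RHS]det_tr; congr (\det _).
by rewrite /char_poly_mx linearB /= tr_scalar_mx map_trmx.
Qed.

(** [eigenvalue] concerns row vectors, hence the detour through the transpose, which has the same
    characteristic polynomial. *)
Lemma root_char_polyP (F : fieldType) (n : nat) (A : 'M[F]_n) (a : F) :
  reflect (exists2 v : 'cV_n, v != 0 & A *m v = a *: v) (root (char_poly A) a).
Proof.
rewrite -char_poly_trmx -eigenvalue_root_char.
apply: (iffP eigenvalueP) => [[v vA v0]|[v v0 Av]]; exists v^T.
- by rewrite trmx_eq0.
- by rewrite -linearZ /= -vA trmx_mul trmxK.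
- by rewrite -trmx_mul Av linearZ.
- by rewrite trmx_eq0.
Qed.

Lemma char_poly_roots2 (F : fieldType) (A : 'M[F]_2) (a b : F) : a != b ->
  root (char_poly A) a -> root (char_poly A) b ->
  char_poly A = ('X - a%:P) * ('X - b%:P).
Proof.
move=> ab ra rb.
rewrite (@all_roots_prod_XsubC _ (char_poly A) [:: a; b]) ?size_char_poly //.
- by rewrite (monicP (char_poly_monic A)) scale1r !big_cons big_nil mulr1.
- by rewrite /= ra rb.
- by rewrite uniq_rootsE /= inE ab.
Qed.

Lemma root_char_poly2 (F : fieldType) (A : 'M[F]_2) (a b x : F) :
  char_poly A = ('X - a%:P) * ('X - b%:P) ->
  root (char_poly A) x = (x == a) || (x == b).
Proof. by move=> ->; rewrite rootM !root_XsubC. Qed.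

(** * Homogeneous coordinates and the Moebius action *)

Section Moebius.
Local Open Scope quotient_scope.
Variable R : realType.
Local Notation C := R[i].
Implicit Types (A B N : 'M[C]_2) (p q r z w : Chat R) (l a b k : C).

(** Inverse to [hom_coord] up to a factor, which is nonzero away from the zero vector; the zero
    vector itself goes to [None] by default. *)
Definition of_hom (v : 'cV[C]_2) : Chat R :=
  if v 1 0 == 0 then None else Some (v 0 0 / v 1 0).

Lemma of_homE (v : 'cV[C]_2) : v != 0 ->
  exists2 k, k != 0 & v = k *: hom_coord (of_hom v).
Proof.
rewrite /of_hom => v0; case: ifPn => [/eqP v1|v1].
  exists (v 0 0).
    by apply: contraNneq v0 => v00; apply/eqP/colvec2P; rewrite mxE.
  by apply: colvec2P; rewrite !mxE /= ?mulr1 ?mulr0.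
by exists (v 1 0) => //; apply: colvec2P; rewrite !mxE /= ?mulr1 // mulrC divfK.
Qed.

Lemma wedge_hom p q : wedge (hom_coord p) (hom_coord q) = bracket p q.
Proof. by []. Qed.

Lemma wedge_hom_neq0 {p q} : p != q -> wedge (hom_coord p) (hom_coord q) != 0.
Proof. by rewrite wedge_hom bracket_eq0. Qed.

Lemma hom_coord_neq0 z : hom_coord z != 0.
Proof.
apply/eqP => /matrixP; case: z => [z|] E.
  by have /eqP := E 1 0; rewrite !mxE /= oner_eq0.
by have /eqP := E 0 0; rewrite !mxE /= oner_eq0.
Qed.

Lemma hom_coord_inj k p q : hom_coord p = k *: hom_coord q -> p = q.
Proof.
move=> E; apply/eqP; rewrite -bracket_eq0 -wedge_hom E.
by rewrite -[X in wedge _ X]scale1r wedgeZ wedge_hom (eqP (_ : bracket q q == 0))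
  ?mulr0 // bracket_eq0.
Qed.

Definition mob A z : Chat R := of_hom (A *m hom_coord z).

Lemma mulmx_hom_coord_neq0 A z : A \in unitmx -> A *m hom_coord z != 0.
Proof.
move=> Au; apply: contraNneq (hom_coord_neq0 z) => E.
by rewrite -(mulKmx Au (hom_coord z)) E mulmx0.
Qed.

Lemma mobE A z : A \in unitmx ->
  exists2 k, k != 0 & A *m hom_coord z = k *: hom_coord (mob A z).
Proof. by move=> Au; apply/of_homE/mulmx_hom_coord_neq0. Qed.

Lemma mob_eq A z w k : A \in unitmx -> A *m hom_coord z = k *: hom_coord w ->
  mob A z = w.
Proof.
move=> Au E; have [c c0 Ec] := mobE z Au.
apply: (@hom_coord_inj (c^-1 * k)).
by rewrite -scalerA -E Ec scalerA mulVf ?scale1r.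
Qed.

Lemma mobK A : A \in unitmx -> cancel (mob A) (mob (invmx A)).
Proof.
move=> Au z; have [k k0 E] := mobE z Au.
apply: (@mob_eq _ _ _ k^-1); first by rewrite unitmx_inv.
by rewrite -[hom_coord (mob A z)]scale1r -(mulVf k0) -scalerA -E -scalemxAr mulKmx.
Qed.

(** * Cross ratios: invariance, conjugation, normalization *)

Lemma cross_ratio_mob A p q r z : A \in unitmx ->
  cross_ratio (mob A p) (mob A q) (mob A r) (mob A z) = cross_ratio p q r z.
Proof.
move=> Au.
have [a a0 Ea] := mobE p Au; have [b b0 Eb] := mobE q Au.
have [c c0 Ec] := mobE r Au; have [d d0 Ed] := mobE z Au.
have A0 : \det A != 0 by rewrite -unitfE.
move: (mob A p) (mob A q) (mob A r) (mob A z) Ea Eb Ec Ed => p' q' r' z' Ea Eb Ec Ed.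
(* Each bracket gains [\det A] and loses the scale factors of its two points. All of these cancel,
   since every point occurs once in the numerator and once in the denominator. *)
have K x y x' y' h k : h != 0 -> k != 0 -> A *m hom_coord x = h *: hom_coord x' ->
    A *m hom_coord y = k *: hom_coord y' ->
    bracket x' y' = \det A * bracket x y / (h * k).
  move=> h0 k0 Eh Ek; rewrite -!wedge_hom -wedge_mulmx Eh Ek wedgeZ.
  by rewrite mulrC mulKf // mulf_neq0.
rewrite /cross_ratio (K _ _ _ _ _ _ a0 d0 Ea Ed) (K _ _ _ _ _ _ c0 b0 Ec Eb).
rewrite (K _ _ _ _ _ _ a0 b0 Ea Eb) (K _ _ _ _ _ _ c0 d0 Ec Ed).
set x := bracket p q; set y := bracket r z.
rewrite !mulf_eq0 !invr_eq0 !mulf_eq0 (negPf A0) (negPf a0) (negPf b0) (negPf c0)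
  (negPf d0) /= !orbF.
case: ifPn => // /norP[x0 y0]; congr Some.
move: (\det A) (bracket p z) (bracket r q) x y x0 y0 A0 => e s t x y x0 y0 e0.
by field; rewrite y0 x0 d0 c0 b0 a0.
Qed.

Lemma cross_ratio_conj p q r z :
  cross_ratio (conj_hat p) (conj_hat q) (conj_hat r) (conj_hat z) =
  conj_hat (cross_ratio p q r z).
Proof.
have K x y : bracket (conj_hat x) (conj_hat y) = conjc (bracket x y).
  rewrite !bracketE; case: x => [x|]; case: y => [y|].
  - by rewrite rmorphB.
  - by rewrite rmorphN rmorph1.
  - by rewrite rmorph1.
  - by rewrite rmorph0.
rewrite /cross_ratio !K -!rmorphM /= conjc_eq0; case: ifP => //= _.
by rewrite fmorph_div.
Qed.

Lemma conjc_realP a : conjc a = a <-> exists x : R, a = x%:C.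
Proof.
split=> [|[x ->]]; last exact: conjc_real.
case: a => x y /= [/eqP]; rewrite eqNr => /eqP ->.
by exists x.
Qed.

Lemma RhatP z : Rhat z <-> conj_hat z = z.
Proof.
rewrite /Rhat; case: z => [z|] /=; last by split=> // _; left.
split=> [[//|[x [->]]]|[/conjc_realP[x ->]]]; last by right; exists x.
by rewrite conjc_real.
Qed.

(** Exchanging the second and fourth points inverts the cross ratio. This turns condition (a) into
    realness of h_2^+ in the coordinate that sends h_2^- to 1. *)
Lemma Rhat_cross_ratio_swap p q r z :
  Rhat (cross_ratio p q r z) -> Rhat (cross_ratio p z r q).
Proof.
rewrite /cross_ratio; set x := _ * bracket r q; set y := _ * bracket r z.
have [x0 _|x0] := eqVneq x 0; first by left.
have [-> _|y0] := eqVneq y 0; first by rewrite mul0r; right; exists 0.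
move=> /RhatP[xy]; apply/RhatP => /=.
by rewrite -[y / x]invf_div fmorphV /= xy.
Qed.

(** After applying [A], conjugation fixes the three reference points, so it only exchanges the
    images of [x] and [y]. *)
Lemma cross_ratio_mob_conj A p x y r z : A \in unitmx ->
  Rhat (mob A p) -> Rhat (mob A r) -> Rhat (mob A z) ->
  mob A x = conj_hat (mob A y) ->
  cross_ratio p x r z = conj_hat (cross_ratio p y r z).
Proof.
move=> Au /RhatP pR /RhatP rR /RhatP zR xy.
rewrite -(cross_ratio_mob p x r z Au) -(cross_ratio_mob p y r z Au).
move: (mob A p) (mob A x) (mob A y) (mob A r) (mob A z) pR rR zR xy.
by move=> p' x' y' r' z' pR rR zR ->; rewrite -cross_ratio_conj pR rR zR.
Qed.

Lemma Rhat_cross_ratio_mob A p q r z : A \in unitmx ->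
  Rhat (mob A p) -> Rhat (mob A q) -> Rhat (mob A r) -> Rhat (mob A z) ->
  Rhat (cross_ratio p q r z).
Proof.
move=> Au pR /RhatP qR rR zR; apply/RhatP; symmetry.
exact: (cross_ratio_mob_conj Au pR rR zR (esym qR)).
Qed.

Lemma three_point_normalization p q r : p != q -> p != r -> q != r ->
  exists2 A, A \in unitmx & forall z, mob A (cross_ratio p z q r) = z.
Proof.
move=> pq; rewrite eq_sym => rp; rewrite eq_sym => rq.
(* The columns represent [p] and [q], the images of infinity = [1 : 0] and 0 = [0 : 1]; their
   weights are chosen so that the sum of the columns, the image of 1, is a multiple of
   [hom_coord r]. *)
pose A : 'M[C]_2 := \matrix_(i, j) if j == 0 then bracket r q * hom_coord p i 0
   else bracket p r * hom_coord q i 0.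
have A0 i : A i 0 = bracket r q * hom_coord p i 0 by rewrite !mxE.
have A1 i : A i 1 = bracket p r * hom_coord q i 0 by rewrite !mxE.
have AE v i : (A *m v) i 0 = v 0 0 * (bracket r q * hom_coord p i 0) +
    v 1 0 * (bracket p r * hom_coord q i 0).
  by rewrite mulmx2E A0 A1; ring.
have Au : A \in unitmx.
  rewrite unitmxE det2E !A0 !A1 unitfE.
  rewrite (_ : _ - _ = bracket r q * bracket p r * bracket p q); first last.
    by move: (bracket r q) (bracket p r) => x y; rewrite /bracket; ring.
  by rewrite !mulf_eq0 !bracket_eq0 (negPf rq) (eq_sym p r) (negPf rp).
exists A => // z; rewrite /cross_ratio mulf_eq0 !bracket_eq0.
rewrite (eq_sym q r) (negPf rq) orbF; case: eqP => [<-|/eqP pz].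
  (* At [z = p] the cross ratio is infinity, whose image is the first column. *)
  apply: (@mob_eq _ _ _ (bracket r q)) => //.
  by apply: colvec2P; rewrite AE !mxE /= mul1r mul0r addr0.
have pz0 : bracket p z != 0 by rewrite bracket_eq0.
have qr0 : bracket q r != 0 by rewrite bracket_eq0 eq_sym.
apply: (@mob_eq _ _ _ (bracket p r * bracket p q / bracket p z)) => //.
(* Linear dependence of three vectors in the plane: the coordinates of [z] in the basis [p], [q]. *)
have Ez i : hom_coord z i 0 * bracket p q =
    bracket p z * hom_coord q i 0 - bracket q z * hom_coord p i 0.
  by rewrite /bracket; elim/ord2P: i; ring.
apply/matrixP => i j; rewrite ord1 AE (bracketC r q) [RHS]mxE.
rewrite [hom_coord (Some _) 0 0]mxE [hom_coord (Some _) 1 0]mxE /=.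
rewrite [RHS](_ : _ = bracket p r / bracket p z * (hom_coord z i 0 * bracket p q));
  last by ring.
rewrite Ez.
move: (bracket p z) (bracket q r) (bracket p r) (bracket q z) pz0 qr0
  => s t x y s0 t0.
by field; rewrite s0 t0.
Qed.

(** * Eigendirections and eigenvalue pairs *)

Definition eigvec A l z := A *m hom_coord z = l *: hom_coord z.

Lemma eigvec_scale k A l z : eigvec A l z -> eigvec (k *: A) (k * l) z.
Proof. by rewrite /eigvec -scalemxAl => ->; rewrite scalerA. Qed.

Lemma eigvec_conjg A B l z : B \in unitmx -> eigvec A l z ->
  eigvec (invmx B *m A *m B) l (mob (invmx B) z).
Proof.
move=> Bu Az; have Bu' : invmx B \in unitmx by rewrite unitmx_inv.
have [k k0 E] := mobE z Bu'; rewrite /eigvec.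
rewrite -[hom_coord (mob _ _)]scale1r -(mulVf k0) -scalerA -E.
by rewrite -scalemxAr -!mulmxA mulKVmx // Az -scalemxAr !scalerA mulrC.
Qed.

Lemma eigvec_root A l z : eigvec A l z -> root (char_poly A) l.
Proof. by move=> Az; apply/root_char_polyP; exists (hom_coord z); rewrite ?hom_coord_neq0. Qed.

Lemma root_eigvec A l : root (char_poly A) l -> exists z, eigvec A l z.
Proof.
case/root_char_polyP=> v /of_homE[k k0 vE] Av; exists (of_hom v).
apply: (scalerI k0).
by rewrite scalemxAr -vE Av {1}vE !scalerA mulrC.
Qed.

Lemma eigvec_inj A l l' z : eigvec A l z -> eigvec A l' z -> l = l'.
Proof.
rewrite /eigvec => -> /eqP; rewrite -subr_eq0 -scalerBl scaler_eq0.
by rewrite (negPf (hom_coord_neq0 z)) orbF subr_eq0 => /eqP.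
Qed.

(** Distinct points have independent coordinate vectors. Realness of a matrix will follow by
    comparing it in this way with its complex conjugate. *)
Lemma eigvec2_eq A B l l' p q : p != q -> eigvec A l p -> eigvec B l p ->
  eigvec A l' q -> eigvec B l' q -> A = B.
Proof.
move=> pq Ap Bp Aq Bq.
by apply: (mulmx_wedge_inj (wedge_hom_neq0 pq)); rewrite (Ap, Aq) (Bp, Bq).
Qed.

(** A second eigendirection for [l] would make [A] the scalar matrix [l], leaving no room for
    [l']. *)
Lemma eigvec_uniq A l l' p q r : l != l' ->
  eigvec A l p -> eigvec A l' q -> eigvec A l r -> r = p.
Proof.
move=> ll' Ap Aq Ar; apply/eqP/idPn => rp; move/eqP: ll'; apply.
have scal z : eigvec l%:M l z by rewrite /eigvec mul_scalar_mx.
have AE : A = l%:M by apply: (eigvec2_eq rp Ar (scal r) Ap (scal p)).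
by apply: eigvec_inj Aq; rewrite AE; apply: scal.
Qed.

Lemma char_poly_eigvec2 A l l' p q : l != l' ->
  eigvec A l p -> eigvec A l' q -> char_poly A = ('X - l%:P) * ('X - l'%:P).
Proof. by move=> ll' Ap Aq; apply: char_poly_roots2 ll' _ _; apply: eigvec_root; eassumption. Qed.

Lemma eigen_basis (M : PGL2 C) (B : GL2 C) z w : distinct_eigenvalues M ->
  eigendirections M = [set z; w] -> \pi_(PGL2 C) B = M ->
  exists l l', [/\ eigvec (val B) l z, eigvec (val B) l' w, l != l' & z != w].
Proof.
move=> [a [b [[A AM cpA] ab]]] Mzw BM.
have ra x := root_char_poly2 x cpA.
have [z1 Az1] : exists z1, eigvec (val A) a z1 by apply: root_eigvec; rewrite ra eqxx.
have [z2 Az2] : exists z2, eigvec (val A) b z2.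
  by apply: root_eigvec; rewrite ra eqxx orbT.
have z12 : z1 != z2.
  by apply: contraNneq ab => E; apply/eqP; apply: eigvec_inj Az1 _; rewrite E.
have [c c0 BA] : exists2 c : C, c != 0 & val B = c *: val A.
  by apply/PGL2_piP/eqP; rewrite BM.
have cab : c * a != c * b by rewrite (inj_eq (mulfI c0)).
have [] : [set z; w] z1 /\ [set z; w] z2.
  by rewrite -Mzw; split; exists A => //; [exists a | exists b].
have Bz1 := eigvec_scale c Az1; have Bz2 := eigvec_scale c Az2.
(* The two eigendirections are distinct, so they exhaust [z] and [w], but in an unknown order; hence
   two surviving cases. *)
rewrite BA => -[] /= E1 [] /= E2; subst z1 z2; rewrite ?eqxx // in z12.
- by exists (c * a), (c * b).
- by exists (c * b), (c * a); rewrite eq_sym cab eq_sym z12.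
Qed.

Section EigenBasis.
Variables (M : PGL2 C) (B : GL2 C) (z w : Chat R) (l l' : C).
Hypothesis BM : \pi_(PGL2 C) B = M.
Hypothesis Bz : eigvec (val B) l z.
Hypothesis Bw : eigvec (val B) l' w.
Hypothesis ll' : l != l'.

Lemma eigenvalue_pair_basis : eigenvalue_pair M l l'.
Proof. by exists B => //; apply: char_poly_eigvec2 ll' Bz Bw. Qed.

(** Representatives differ by a scalar [k], so [k * l] and [k * l'] are two distinct roots of a
    polynomial with roots [a] and [b]; only the order is free. *)
Lemma eigenvalue_pairE a b : eigenvalue_pair M a b ->
  exists2 k, k != 0 & a = k * l /\ b = k * l' \/ a = k * l' /\ b = k * l.
Proof.
move=> [A AM cpA].
have [k k0 AB] : exists2 k : C, k != 0 & val A = k *: val B.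
  by apply/PGL2_piP/eqP; rewrite BM.
exists k => //.
have := eigvec_root (eigvec_scale k Bz); have := eigvec_root (eigvec_scale k Bw).
rewrite -AB !(root_char_poly2 _ cpA).
have kll' : k * l != k * l' by rewrite (inj_eq (mulfI k0)).
case/orP => /eqP E' /orP[]/eqP E; rewrite ?E ?E' ?eqxx // in kll' *.
- by right.
- by left.
Qed.

(** Changing the representative multiplies both eigenvalues by some [k]; dividing [u] by [k] moves
    the line accordingly, so a single representative decides. *)
Lemma hyperbolic_basisP : hyperbolic M <->
  exists2 u : C, u != 0 & real_line u l /\ real_line u l'.
Proof.
split=> [[a [b [/eigenvalue_pairE[k k0 E] [u u0 [ua ub]]]]]|]; last first.
  by exists l, l'; split=> //; apply: eigenvalue_pair_basis.
exists (u / k); first by rewrite mulf_neq0 ?invr_eq0.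
have K x : real_line u (k * x) -> real_line (u / k) x.
  by move=> [t E']; exists t; rewrite mulrA -E' mulrC mulKf.
by case: E => -[Ea Eb]; move: ua ub; rewrite Ea Eb => ua ub; split; apply: K.
Qed.

Lemma elliptic_basisP : elliptic M <->
  exists2 u : C, u != 0 & reflection u l = l' /\ reflection u l' = l.
Proof.
split=> [[a [b [/eigenvalue_pairE[k k0 E] [u u0 [ua ub]]]]]|]; last first.
  by exists l, l'; split=> //; apply: eigenvalue_pair_basis.
exists (u / k); first by rewrite mulf_neq0 ?invr_eq0.
(* Multiplication by [k] conjugates reflection about the line of [u / k] into reflection about the
   line of [u]. *)
have K x y : reflection u (k * x) = k * y -> reflection (u / k) x = y.
  rewrite /reflection => E'; apply: (mulfI k0); rewrite -E' fmorph_div rmorphM /=.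
  by field; rewrite !conjc_eq0 u0 k0.
by case: E => -[Ea Eb]; move: ua ub; rewrite Ea Eb => ua ub; split; apply: K.
Qed.

End EigenBasis.

(** * Complex conjugation and real classes *)

Lemma hom_coord_conj z : hom_coord (conj_hat z) = map_mx (@conjc R) (hom_coord z).
Proof.
case: z => [z|]; apply: colvec2P; rewrite !mxE //; apply: esym;
  by [apply: conjc1 | apply: conjc0].
Qed.

Lemma eigvec_conj A l z :
  eigvec A l z -> eigvec (map_mx (@conjc R) A) (conjc l) (conj_hat z).
Proof. by rewrite /eigvec hom_coord_conj -map_mxM => ->; rewrite map_mxZ. Qed.

Lemma conj_hatK : involutive (@conj_hat R).
Proof. by case=> [z|] //=; rewrite conjcK. Qed.

(** Conjugation permutes the roots of the characteristic polynomial of [N], either fixing or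
    swapping them; uniqueness of the eigendirection of each root makes the directions follow. *)
Lemma real_mx_eigvec N l l' p q : map_mx (@conjc R) N = N ->
  eigvec N l p -> eigvec N l' q -> l != l' ->
  [/\ conjc l = l, conjc l' = l', conj_hat p = p & conj_hat q = q] \/
  conjc l = l' /\ p = conj_hat q.
Proof.
move=> NR Np Nq ll'.
have Np' := eigvec_conj Np; have Nq' := eigvec_conj Nq; rewrite NR in Np' Nq'.
have ra x := root_char_poly2 x (char_poly_eigvec2 ll' Np Nq).
have l'l : l' != l by rewrite eq_sym.
have /orP[/eqP El|/eqP El] : (conjc l == l) || (conjc l == l').
- by rewrite -ra; apply: eigvec_root Np'.
- left; have /orP[/eqP El'|/eqP El'] : (conjc l' == l) || (conjc l' == l').
  + by rewrite -ra; apply: eigvec_root Nq'.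
  + by move: ll'; rewrite -(inj_eq (can_inj (@conjcK R))) El El' eqxx.
  rewrite El in Np'; rewrite El' in Nq'; split=> //.
  + exact: eigvec_uniq Np Nq Np'.
  + exact: eigvec_uniq l'l Nq Np Nq'.
- right; split=> //; rewrite El in Np'.
  by rewrite -(eigvec_uniq l'l Nq Np Np') conj_hatK.
Qed.

Lemma PGL2_realP (M : PGL2 C) : PGL2_real M <->
  exists2 N : GL2 C, map_mx (@conjc R) (val N) = val N & \pi_(PGL2 C) N = M.
Proof.
split=> [[A _ <-]|[N NR <-]].
  by exists (GL2_complex A) => //; apply/matrixP => i j; rewrite !mxE conjc_real.
pose A : 'M[R]_2 := \matrix_(i, j) complex.Re (val N i j).
have AN : map_mx (real_complex R) A = val N.
  apply/matrixP => i j; rewrite !mxE.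
  have /conjc_realP[x ->] : conjc (val N i j) = val N i j by rewrite -[in RHS]NR mxE.
  by [].
have Au : A \in unitmx by rewrite -(map_unitmx (real_complex R)) AN (valP N).
exists (MkGL2 Au) => //; congr (\pi_(PGL2 C) _); apply: val_inj; exact: AN.
Qed.

Lemma PGL2_real_conjgP (M : PGL2 C) (g : GL2 C) :
  PGL2_real ((\pi_(PGL2 C) g)^-1 * M * \pi_(PGL2 C) g)%g <->
  exists2 B : GL2 C, \pi_(PGL2 C) B = M &
    map_mx (@conjc R) (invmx (val g) *m val B *m val g) =
    invmx (val g) *m val B *m val g.
Proof.
have piM (A B : GL2 C) : (\pi_(PGL2 C) A * \pi_(PGL2 C) B)%g = \pi_(PGL2 C) (A * B)%g.
  exact: PGL2_piM.
have piV (A : GL2 C) : ((\pi_(PGL2 C) A)^-1)%g = \pi_(PGL2 C) (A^-1)%g.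
  exact: PGL2_piV.
rewrite PGL2_realP; split=> [[N NR NE]|[B BM BR]]; last first.
  exists (g^-1 * B * g)%g; first exact: BR.
  by rewrite -BM piV (piM g^-1%g B) piM.
exists (g * N * g^-1)%g.
  by rewrite -!piM -piV NE !mulgA mulgV mul1g mulgK.
suff -> : invmx (val g) *m val (g * N * g^-1)%g *m val g = val N by [].
(* The matrix product is convertible to the underlying matrix of a product in [GL2], where the group
   laws apply. *)
by rewrite -[LHS]/(val (g^-1 * (g * N * g^-1) * g)%g) !mulgA mulVg mul1g mulgVK.
Qed.

(** * Realness criteria for a single transformation *)

Lemma GL2_scale k (B : GL2 C) : k != 0 ->
  exists2 A : GL2 C, \pi_(PGL2 C) A = \pi_(PGL2 C) B & val A = k *: val B.
Proof.
move=> k0; have kBu : k *: val B \in unitmx by rewrite unitmxZ ?unitfE ?(valP B).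
by exists (MkGL2 kBu) => //; apply/eqP/PGL2_piP; exists k.
Qed.

(** [~ elliptic M] excludes involutions: a real matrix with eigenvalues i and -i is hyperbolic as
    well, yet its eigendirections are conjugate and not real. *)
Lemma hyperbolic_conjg_real (M : PGL2 C) (g : GL2 C) z w :
  hyperbolic M -> ~ elliptic M -> distinct_eigenvalues M ->
  eigendirections M = [set z; w] ->
  PGL2_real ((\pi_(PGL2 C) g)^-1 * M * \pi_(PGL2 C) g)%g <->
  Rhat (mob (invmx (val g)) z) /\ Rhat (mob (invmx (val g)) w).
Proof.
move=> Mh Me Md Mzw; rewrite PGL2_real_conjgP !RhatP.
have gu := valP g; split=> [[B BM BR]|[zR wR]].
  have [l [l' [Bz Bw ll' zw]]] := eigen_basis Md Mzw BM.
  have [[]//|[lE _]] :=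
    real_mx_eigvec BR (eigvec_conjg gu Bz) (eigvec_conjg gu Bw) ll'.
  (* Conjugate eigenvalues are swapped by reflection about the real axis. *)
  case: Me; apply/(elliptic_basisP BM Bz Bw ll'); exists 1; first exact: oner_neq0.
  by rewrite /reflection conjc1 divr1 !mul1r -lE conjcK.
elim/quotW: M Mh Me Md Mzw => B Mh Me Md Mzw.
have [l [l' [Bz Bw ll' zw]]] := eigen_basis Md Mzw erefl.
have /(hyperbolic_basisP erefl Bz Bw ll')[u u0 [[s ls] [t lt]]] := Mh.
(* Rotating the eigenvalue line onto the real axis makes the representative real. *)
have [A AB AE] := GL2_scale B (invr_neq0 u0); exists A => //.
have Az := eigvec_conjg gu (eigvec_scale u^-1 Bz).
have Aw := eigvec_conjg gu (eigvec_scale u^-1 Bw).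
have uK x : u^-1 * (x * u) = x by rewrite mulrCA mulVf ?mulr1.
rewrite -AE ls lt !uK in Az Aw.
apply: (eigvec2_eq _ _ Az _ Aw).
- by rewrite (can_eq (mobK _)) // unitmx_inv.
- by have := eigvec_conj Az; rewrite zR conjc_real.
- by have := eigvec_conj Aw; rewrite wR conjc_real.
Qed.

(** [~ hyperbolic M] excludes involutions such as diag(1, -1), which is real with two distinct real
    eigendirections. *)
Lemma elliptic_conjg_real (M : PGL2 C) (g : GL2 C) z w :
  elliptic M -> ~ hyperbolic M -> distinct_eigenvalues M ->
  eigendirections M = [set z; w] ->
  PGL2_real ((\pi_(PGL2 C) g)^-1 * M * \pi_(PGL2 C) g)%g <->
  mob (invmx (val g)) z = conj_hat (mob (invmx (val g)) w).
Proof.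
move=> Me Mh Md Mzw; rewrite PGL2_real_conjgP.
have gu := valP g; split=> [[B BM BR]|zwR].
  have [l [l' [Bz Bw ll' zw]]] := eigen_basis Md Mzw BM.
  have [[lR l'R _ _]|[]//] :=
    real_mx_eigvec BR (eigvec_conjg gu Bz) (eigvec_conjg gu Bw) ll'.
  case: Mh; apply/(hyperbolic_basisP BM Bz Bw ll'); exists 1; first exact: oner_neq0.
  have [s sE] := (conjc_realP l).1 lR; have [t tE] := (conjc_realP l').1 l'R.
  by split; [exists s | exists t]; rewrite mulr1.
elim/quotW: M Me Mh Md Mzw => B Me Mh Md Mzw.
have [l [l' [Bz Bw ll' zw]]] := eigen_basis Md Mzw erefl.
have /(elliptic_basisP erefl Bz Bw ll')[u u0 [ul ul']] := Me.
have [A AB AE] := GL2_scale B (invr_neq0 u0); exists A => //.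
have Az := eigvec_conjg gu (eigvec_scale u^-1 Bz).
have Aw := eigvec_conjg gu (eigvec_scale u^-1 Bw).
(* Dividing by [u] turns reflection about [real_line u] into complex conjugation. *)
have lE : u^-1 * l' = conjc (u^-1 * l).
  by rewrite -ul /reflection rmorphM fmorphV /=; field; rewrite conjc_eq0 u0.
have l'E : u^-1 * l = conjc (u^-1 * l') by rewrite lE conjcK.
rewrite -AE in Az Aw.
apply: (eigvec2_eq _ _ Az _ Aw).
- by rewrite (can_eq (mobK _)) // unitmx_inv.
- by have := eigvec_conj Aw; rewrite -l'E -zwR.
- by have := eigvec_conj Az; rewrite -lE zwR conj_hatK.
Qed.

End Moebius.

(** * The criterion for the whole collection *)

Unset Implicit Arguments.

Theorem theorem5 (R : realType) (m n : nat) (m_ge2 : (2 <= m)%N)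
    (H : 'I_m -> PGL2 R[i]) (E : 'I_n -> PGL2 R[i])
    (hm hp : 'I_m -> Chat R) (em ep : 'I_n -> Chat R)
    (i1 i2 : 'I_m) (i1E : i1 = 0%N :> nat) (i2E : i2 = 1%N :> nat)
    (H_hyp : forall i, hyperbolic (H i))
    (E_ell : forall j, elliptic (E j))
    (H_distinct : forall i, distinct_eigenvalues (H i))
    (E_distinct : forall j, distinct_eigenvalues (E j))
    (H_not_ell : forall i, ~ elliptic (H i))
    (E_not_hyp : forall j, ~ hyperbolic (E j))
    (h_eig : forall i, eigendirections (H i) = [set hm i; hp i])
    (e_eig : forall j, eigendirections (E j) = [set em j; ep j])
    (H12 : eigendirections (H i1) <> eigendirections (H i2))
    (hm2_notin : ~ eigendirections (H i1) (hm i2)) :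
  simultaneously_conjugate_into_PGL2_real (range H `|` range E)
  <->
  [/\ Rhat (cross_ratio (hm i1) (hm i2) (hp i1) (hp i2)),
      forall i : 'I_m, (1 < i)%N ->
        Rhat (cross_ratio (hm i1) (hm i) (hp i1) (hm i2)),
      forall i : 'I_m, (1 < i)%N ->
        Rhat (cross_ratio (hm i1) (hp i) (hp i1) (hm i2)) &
      forall j : 'I_n,
        cross_ratio (hm i1) (em j) (hp i1) (hm i2) =
        conj_hat (cross_ratio (hm i1) (ep j) (hp i1) (hm i2))].
Proof.
have e1 (i : 'I_m) : i = i1 \/ i = i2 \/ (1 < i)%N.
  case: i => -[|[|i]] Hi; [left|right; left|by right; right];
    by apply: val_inj; rewrite /= (i1E, i2E).
have hmp i : hm i != hp i.
  have : exists A, \pi_(PGL2 R[i])%qT A = H i by exists (repr (H i)); rewrite reprK.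
  by case=> A /(eigen_basis (H_distinct i) (h_eig i))[l [l' []]].
(* With [hmp i1], this makes h_1^-, h_1^+, h_2^- three distinct points, as the normalization
   requires. *)
have h12 : hm i1 != hm i2.
  by apply/eqP => E12; apply: hm2_notin; rewrite h_eig -E12; left.
have h12' : hp i1 != hm i2.
  by apply/eqP => E12; apply: hm2_notin; rewrite h_eig -E12; right.
have realH g i := hyperbolic_conjg_real g (H_hyp i) (H_not_ell i) (H_distinct i) (h_eig i).
have realE g j := elliptic_conjg_real g (E_ell j) (E_not_hyp j) (E_distinct j) (e_eig j).
split=> [[G GR]|[a b c d]].
  elim/quotW: G GR => g GR.
  have gu : invmx (val g) \in unitmx by rewrite unitmx_inv (valP g).
  have {}realH i : Rhat (mob (invmx (val g)) (hm i)) /\ Rhat (mob (invmx (val g)) (hp i)).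
    by apply/realH/GR; left; exists i.
  have [[p_real q_real] [r_real s_real]] := (realH i1, realH i2).
  split=> [|i _|i _|j].
  - exact: Rhat_cross_ratio_mob gu p_real r_real q_real s_real.
  - exact: Rhat_cross_ratio_mob gu p_real (realH i).1 q_real r_real.
  - exact: Rhat_cross_ratio_mob gu p_real (realH i).2 q_real r_real.
  apply: (cross_ratio_mob_conj gu p_real q_real r_real).
  by apply/realE/GR; right; exists j.
have [A Au AE] := three_point_normalization (hmp i1) h12 h12'.
pose g := MkGL2 Au.
(* [A] undoes the cross ratio coordinate, so the inverse of [g] acts as that coordinate and
   conditions (b)-(d) become realness statements about it. *)
have gE z : mob (invmx (val g)) z = cross_ratio (hm i1) z (hp i1) (hm i2).
  by rewrite -{1}(AE z) mobK.
exists (\pi_(PGL2 R[i])%qT g) => M [[i _ <-]|[j _ <-]].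
  apply/realH; rewrite !gE; have [->|[->|i_gt1]] := e1 i.
  (* The eigendirections of H_1 go to infinity and 0. *)
  - rewrite cross_ratio_infty cross_ratio0 //; split; first by left.
    by right; exists 0.
  (* For H_2, h_2^- goes to 1, and h_2^+ is handled by (a) with its second and fourth points
     exchanged. *)
  - rewrite cross_ratio1 //; split; first by right; exists 1.
    exact: Rhat_cross_ratio_swap.
  - by split; [apply: b|apply: c].
by apply/realE; rewrite !gE.
Qed.
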